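(* Let $F(v)=\frac12(v^2-\sin^2 v)$ and $f(v)=F'(v)=v-\frac12\sin(2v)$ for $v\in\mathbb R$. The following holds: $$f(z_1)(z_2-z_1)\le F(z_2)-F(z_1)\quad\text{for all }z_1,z_2\in\mathbb R,$$ $$\left(\frac{f(u)}{r^2},w-u\right)_{0,r}\le\tfrac12\left(\|w\|_{H^1_r}^2-\|u\|_{H^1_r}^2\right)+\mathcal E(u)-\mathcal E(w)\quad\text{for all }u,w\in H^1_{r,0}.$$
   Context: $I=[0,1]$. $(v,w)_{0,r}=\int_0^1 v(r)w(r)\,r\,dr$ with norm $\|\cdot\|_{0,r}$, and $\|v\|_{H^1_r}^2=\|\partial_r v\|_{0,r}^2+\left\|\frac vr\right\|_{0,r}^2$. $H^1_{r,0}=\{v:I\to\mathbb R:\ \|v\|_{0,r}<\infty,\ \|v\|_{H^1_r}<\infty,\ v(0)=v(1)=0\}$ (with $\partial_r v$ the weak derivative and point values those of the continuous representative). The energy is $\mathcal E(v)=\frac12\int_0^1\left((\partial_r v)^2+\frac{\sin^2 v}{r^2}\right)r\,dr$. *)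

(* Defs.v *)
From HB Require Import structures.
From mathcomp Require Import all_boot all_order all_algebra.
From mathcomp Require Import all_classical all_reals all_analysis.

Set Implicit Arguments.
Unset Strict Implicit.
Unset Printing Implicit Defensive.

Import Order.TTheory GRing.Theory Num.Theory.
Import numFieldNormedType.Exports.

Local Open Scope ring_scope.
Local Open Scope classical_set_scope.

(* Functions on I = [0, 1] are represented by total functions R -> R; only
   their values on [0, 1] matter. *)

Section spaces.
Context {R : realType}.
Implicit Types v w g phi : R -> R.

(* C_c^oo(]0, 1[) *)
Definition test_function phi : Prop :=
  [/\ forall (n : nat) (x : R), derivable (derive1n n phi) x 1,
      compact (closure [set x | phi x != 0]) &
      closure [set x | phi x != 0] `<=` `]0, 1[].

Definition is_weak_deriv v g : Prop :=
  [/\ locally_integrable `]0, 1[ v,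
      locally_integrable `]0, 1[ g &
      forall phi, test_function phi ->
        (\int[@lebesgue_measure R]_(x in `]0%R, 1%R[) (v x * derive1 phi x)%:E =
         - \int[@lebesgue_measure R]_(x in `]0%R, 1%R[) (g x * phi x)%:E)%E].

Definition weakly_derivable v : Prop := exists g, is_weak_deriv v g.

(* A weak derivative is unique up to almost everywhere equality; weak_deriv
   selects one (and is 0 when there is none). *)
Definition weak_deriv v : R -> R := xget (cst 0) [set g | is_weak_deriv v g].

Definition dotr v w : \bar R :=
  \int[@lebesgue_measure R]_(r in `[0%R, 1%R]) (v r * w r * r)%:E.

Definition norm0r v : \bar R := sqrte (dotr v v).

(* The value at r = 0 of v r / r (and of the integrands below) is junk, on a
   set of measure zero. *)
Definition normH1r v : \bar R :=
  sqrte (norm0r (weak_deriv v) ^+ 2 + norm0r (fun r => (v r / r)%R) ^+ 2)%E.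

(* Point values are those of the continuous representative c. *)
Definition H1r0 : set (R -> R) :=
  [set v | [/\ weakly_derivable v,
               (norm0r v < +oo)%E,
               (normH1r v < +oo)%E &
               exists c : R -> R,
                 [/\ {within `[0, 1], continuous c},
                     {ae @lebesgue_measure R, forall x, `[0, 1] x -> v x = c x},
                     c 0 = 0 & c 1 = 0]]].

Definition energy v : \bar R :=
  ((2^-1)%:E * \int[@lebesgue_measure R]_(r in `[0%R, 1%R])
    (((weak_deriv v r) ^+ 2 + (sin (v r)) ^+ 2 / r ^+ 2) * r)%:E)%E.

Definition bigF (v : R) : R := 2^-1 * (v ^+ 2 - (sin v) ^+ 2).

Definition smallf (v : R) : R := v - 2^-1 * sin (2 * v).

End spaces.

(* Main.v *)
Require Import Defs.
From HB Require Import structures.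
From mathcomp Require Import all_boot all_order all_algebra.
From mathcomp Require Import all_classical all_reals all_analysis.
From mathcomp Require Import measurable_realfun ring lra.

Import Order.TTheory GRing.Theory Num.Theory.
Import numFieldNormedType.Exports.

Local Open Scope ring_scope.

(** The function [bigF] is convex, because its derivative [smallf] has the
    nonnegative derivative [1 - cos (2 v)]; the first inequality says that
    its graph lies above its tangents.

    The second inequality is the first one, taken at [z1 = u r], [z2 = w r],
    multiplied by the weight [1 / r] and integrated over the unit interval.
    The right-hand side is indeed such an integral: the Dirichlet terms of
    half the squared norm and of the energy cancel, so that
      [2^-1 * normH1r v ^+ 2 - energy v = \int (bigF (v r) / r)]
    (lemma [half_normH1r_sub_energy]).  The cancellation takes place among
    extended reals, hence requires finiteness: the finite norm makes
    [v r ^+ 2 / r] integrable, and [bigF v], [sin v ^+ 2] and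
    [smallf u * (w - u)] are all dominated by combinations of [u ^+ 2],
    [v ^+ 2] and [w ^+ 2]. *)

(** * The nonlinearity and its convexity *)

Section nonlinearity.
Context {R : realType}.
Implicit Types v z : R.

Lemma is_derive_bigF v : is_derive v 1 (@bigF R) (smallf v).
Proof.
rewrite /bigF.
apply: is_derive_eq.
by rewrite /smallf mulr_natl sin_mulr2n /GRing.scale /=; field.
Qed.

Lemma is_derive_smallf v : is_derive v 1 (@smallf R) (1 - cos (2 * v)).
Proof.
rewrite /smallf.
have sin2 : is_derive v 1 (fun x : R => sin (2 * x)) (2 * cos (2 * v)).
  have -> : (fun x : R => sin (2 * x)) = (@sin R) \o (fun x => 2 * x) by [].
  apply: is_derive_eq.
  by rewrite /GRing.scale /=; ring.
apply: is_derive_eq.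
by rewrite /GRing.scale /=; field.
Qed.

Lemma MVT_is_derive (f df : R -> R) (a b : R) : a <= b ->
  (forall x : R, is_derive x 1 f (df x)) ->
  exists2 c, a <= c <= b & f b - f a = df c * (b - a).
Proof.
move=> ab fdf.
have cf : {within `[a, b], continuous f}%classic.
  apply: derivable_within_continuous => x _.
  exact: ex_derive.
have [c cab ->] := @MVT_segment R f df a b ab (fun x _ => fdf x) cf.
by exists c.
Qed.

Lemma smallf_nondecreasing : {homo (@smallf R) : x y / x <= y}.
Proof.
move=> x y xy; rewrite -subr_ge0.
have [c _ ->] := MVT_is_derive _ _ _ _ xy is_derive_smallf.
by rewrite mulr_ge0 ?subr_ge0 ?cos_le1.
Qed.

(** On either side of [z1] the mean value theorem gives a slope
    [smallf c], which monotonicity compares with [smallf z1]. *)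
Lemma bigF_above_tangent z1 z2 :
  smallf z1 * (z2 - z1) <= bigF z2 - bigF z1.
Proof.
have [z12|/ltW z21] := leP z1 z2.
- have [c /andP[/smallf_nondecreasing z1c _] ->] :=
    MVT_is_derive _ _ _ _ z12 is_derive_bigF.
  by rewrite ler_wpM2r ?subr_ge0.
- have [c /andP[_ /smallf_nondecreasing cz1] Fz] :=
    MVT_is_derive _ _ _ _ z21 is_derive_bigF.
  rewrite -(opprB z1 z2) -(opprB (bigF z1)) mulrN lerN2 Fz.
  by rewrite ler_wpM2r ?subr_ge0.
Qed.

(** [bigF] vanishes at 0 with zero slope, so its tangent there is the axis. *)
Lemma bigF_ge0 v : 0 <= bigF v.
Proof.
have f0 : smallf (0 : R) = 0 by rewrite /smallf mulr0 sin0 mulr0 subr0.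
have F0 : bigF (0 : R) = 0 by rewrite /bigF sin0 subrr mulr0.
by have := bigF_above_tangent 0 v; rewrite f0 F0 mul0r subr0.
Qed.

Lemma sin_sqr_le v : sin v ^+ 2 <= v ^+ 2.
Proof. by have := bigF_ge0 v; rewrite /bigF; lra. Qed.

Lemma bigF_le v : bigF v <= v ^+ 2.
Proof. by rewrite /bigF; have := sqr_ge0 (sin v); have := sqr_ge0 v; lra. Qed.

(** Twice the product is at most [smallf z1 ^+ 2 + (z2 - z1) ^+ 2], and
    each square is bounded through [(a - b)^2 <= 2 a^2 + 2 b^2], with
    [sin_sqr_le] at [2 * z1] for the first. *)
Lemma smallf_mul_le z1 z2 :
  `|smallf z1 * (z2 - z1)| <= 3 * z1 ^+ 2 + z2 ^+ 2.
Proof.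
have s2 := sin_sqr_le (2 * z1).
have f2 : smallf z1 ^+ 2 <= 4 * z1 ^+ 2.
  rewrite /smallf; set s := sin _ in s2 *.
  by have := sqr_ge0 (z1 + 2^-1 * s); nra.
have d2 : (z2 - z1) ^+ 2 <= 2 * z1 ^+ 2 + 2 * z2 ^+ 2.
  by have := sqr_ge0 (z1 + z2); nra.
set f := smallf z1 in f2 *; set d := z2 - z1 in d2 *.
rewrite ler_norml; apply/andP; split.
- by have := sqr_ge0 (f + d); nra.
- by have := sqr_ge0 (f - d); nra.
Qed.

Lemma measurable_bigF : measurable_fun setT (@bigF R).
Proof.
apply: continuous_measurable_fun => v.
apply: differentiable_continuous; apply/derivable1_diffP.
exact: (@ex_derive _ _ _ _ _ _ _ (is_derive_bigF v)).
Qed.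

Lemma measurable_smallf : measurable_fun setT (@smallf R).
Proof.
apply: continuous_measurable_fun => v.
apply: differentiable_continuous; apply/derivable1_diffP.
exact: (@ex_derive _ _ _ _ _ _ _ (is_derive_smallf v)).
Qed.

End nonlinearity.

(** * Integrability for the weight 1 / r *)

Local Open Scope classical_set_scope.

Section integrability.
Context {R : realType}.
Implicit Types (u v w g : R -> R) (r : R).

Local Notation mu := (@lebesgue_measure R).
Local Notation I := (`[0, 1]%classic : set R).
Local Notation intI := (fun h : R -> R => mu.-integrable I (EFin \o h)).

Lemma measurable_inv_unit_itv : measurable_fun I (@GRing.inv R).
Proof.
apply: (@measurable_fun_itv_cc _ _ _ false true).
apply: open_continuous_measurable_fun; first exact: interval_open.
move=> x; rewrite inE /= in_itv /= => /andP[x0 _].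
by apply: inv_continuous; rewrite gt_eqF.
Qed.

Lemma ge0_integrable (h : R -> R) :
  measurable_fun I h -> (forall r, 0 <= r -> 0 <= h r) ->
  (\int[mu]_(r in I) (h r)%:E < +oo)%E -> intI h.
Proof.
move=> mh h0 hoo; apply/integrableP; split; first exact/measurable_EFinP.
apply: le_lt_trans hoo; rewrite le_eqVlt; apply/orP; left; apply/eqP.
apply: eq_integral => r; rewrite inE /= in_itv /= => /andP[r0 _].
by rewrite ger0_norm// h0.
Qed.

Lemma integral_Rintegral (h : R -> R) : intI h ->
  (\int[mu]_(r in I) (h r)%:E)%E = (Rintegral mu I h)%:E.
Proof. by move=> ih; rewrite /Rintegral fineK// integrable_fin_num. Qed.

(* At r = 0 both sides of the next three equations vanish, as 0^-1 = 0. *)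
Lemma div_sqrE v r : v r / r * (v r / r) * r = v r ^+ 2 / r.
Proof. by have [->|r0] := eqVneq r 0; [rewrite invr0 !mulr0|field]. Qed.

Lemma energy_densityE (a s r : R) :
  (a ^+ 2 + s / r ^+ 2) * r = a ^+ 2 * r + s / r.
Proof. by have [->|r0] := eqVneq r 0; [rewrite invr0 !mulr0 addr0|field]. Qed.

Lemma div_sqr_mulE (a b r : R) : a / r ^+ 2 * b * r = a * b / r.
Proof. by have [->|r0] := eqVneq r 0; [rewrite invr0 !mulr0|field]. Qed.

Lemma dotrr_ge0 v : (0 <= dotr v v)%E.
Proof.
apply: integral_ge0 => r; rewrite /= in_itv /= => /andP[r0 _].
by rewrite lee_fin mulr_ge0// -expr2 sqr_ge0.
Qed.

Lemma normH1r_sqrE v : (normH1r v ^+ 2 =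
  dotr (weak_deriv v) (weak_deriv v) +
  dotr (fun r => v r / r)%R (fun r => v r / r)%R)%E.
Proof.
have d0 := dotrr_ge0.
by rewrite /normH1r /norm0r !sqr_sqrte// adde_ge0.
Qed.

(** Measurability is part of local integrability on the open interval, and
    adding two points preserves it; each integral is finite as one of the two
    nonnegative terms of the squared norm. *)
Lemma H1r0_integrable v : H1r0 v ->
  [/\ measurable_fun I v, intI (fun r => weak_deriv v r ^+ 2 * r) &
      intI (fun r => v r ^+ 2 / r)].
Proof.
move=> [/(xgetPex (cst 0))[[mv _ _] [mg _ _] _] _ voo _].
rewrite -/(weak_deriv v) in mg.
move/measurable_fun_itv_cc: mv => mv.
move/measurable_fun_itv_cc: mg => mg.
have /andP[goo boo] : (dotr (weak_deriv v) (weak_deriv v) < +oo)%E &&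
    (dotr (fun r => v r / r)%R (fun r => v r / r)%R < +oo)%E.
  have : (normH1r v ^+ 2 < +oo)%E.
    have := sqrte_ge0 (norm0r (weak_deriv v) ^+ 2
                     + norm0r (fun r => v r / r)%R ^+ 2)%E.
    rewrite -/(normH1r v); case: (normH1r v) voo => // x _ _.
    by rewrite expe2 -EFinM ltry.
  rewrite normH1r_sqrE; have := dotrr_ge0 (weak_deriv v).
  have := dotrr_ge0 (fun r => v r / r).
  by case: (dotr (weak_deriv _) _) => [x||] //; case: (dotr _ _) => [y||] //;
    rewrite ?ltry.
split => //.
- apply: ge0_integrable => //.
  + apply: measurable_funM; last exact: measurable_id.
    exact: measurable_funX.
  + by move=> r r0; rewrite mulr_ge0 ?sqr_ge0.
- apply: ge0_integrable => //.
  + apply: measurable_funM; last exact: measurable_inv_unit_itv.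
    exact: measurable_funX.
  + by move=> r r0; rewrite mulr_ge0 ?sqr_ge0 ?invr_ge0.
  + by under eq_integral do rewrite -div_sqrE.
Qed.

Lemma intI_le_weight (h b : R -> R) :
  measurable_fun I h -> intI (fun r => b r / r) ->
  (forall r, `|h r| <= b r) -> intI (fun r => h r / r).
Proof.
move=> mh ib hb; apply: (le_integrable _ _ _ ib) => //.
- apply/measurable_EFinP; apply: measurable_funM => //.
  exact: measurable_inv_unit_itv.
- move=> r _ /=; rewrite lee_fin !normrM ler_wpM2r//.
  exact: le_trans (hb r) (ler_norm _).
Qed.

Lemma intI_bigF v : H1r0 v -> intI (fun r => bigF (v r) / r).
Proof.
move=> /H1r0_integrable[mv _ iv]; apply: (intI_le_weight _ _ _ iv).
- exact: measurableT_comp (@measurable_bigF R) mv.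
- by move=> r; rewrite ger0_norm ?bigF_ge0 ?bigF_le.
Qed.

Lemma intI_sin_sqr v : H1r0 v -> intI (fun r => sin (v r) ^+ 2 / r).
Proof.
move=> /H1r0_integrable[mv _ iv]; apply: (intI_le_weight _ _ _ iv).
- apply: measurable_funX.
  exact: measurableT_comp (continuous_measurable_fun (@continuous_sin R)) mv.
- by move=> r; rewrite ger0_norm ?sqr_ge0 ?sin_sqr_le.
Qed.

Lemma intI_smallf u w : H1r0 u -> H1r0 w ->
  intI (fun r => smallf (u r) * (w r - u r) / r).
Proof.
move=> /H1r0_integrable[meas_u _ iu] /H1r0_integrable[meas_w _ iw].
apply: (@intI_le_weight _ (fun r => 3 * u r ^+ 2 + w r ^+ 2)).
- apply: measurable_funM; last exact: measurable_funB.
  exact: measurableT_comp (@measurable_smallf R) meas_u.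
- have i3 : intI (fun r => 3 * (u r ^+ 2 / r)).
    by apply: (integrableZl _ 3 iu).
  apply: eq_integrable (integrableD _ i3 iw) => // r _ /=.
  by rewrite -EFinD [in RHS]mulrDl mulrA.
- by move=> r; exact: smallf_mul_le.
Qed.

(** * Half the squared norm minus the energy *)

(** The energy differs from half the squared norm only by [sin v ^+ 2] in
    place of [v ^+ 2], and [bigF] is half the difference of these. *)
Lemma half_normH1r_sub_energy v : H1r0 v -> exists a e : R,
  [/\ (normH1r v ^+ 2)%E = a%:E, energy v = e%:E &
      2^-1 * a - e = Rintegral mu I (fun r => bigF (v r) / r)].
Proof.
move=> Hv; have [mv ig iv] := H1r0_integrable _ Hv.
have isin := intI_sin_sqr _ Hv.
set A := Rintegral mu I (fun r => weak_deriv v r ^+ 2 * r).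
set B := Rintegral mu I (fun r => v r ^+ 2 / r).
set S := Rintegral mu I (fun r => sin (v r) ^+ 2 / r).
exists (A + B), (2^-1 * (A + S)); split.
- rewrite normH1r_sqrE /dotr EFinD -!integral_Rintegral//; congr (_ + _)%E.
  by under eq_integral do rewrite div_sqrE.
- rewrite /energy EFinM; congr (_ * _)%E.
  rewrite EFinD -!integral_Rintegral// -integralD//.
  by apply: eq_integral => r _; rewrite energy_densityE EFinD.
- have -> : 2^-1 * (A + B) - 2^-1 * (A + S) = 2^-1 * (B - S) by ring.
  rewrite -RintegralB// -RintegralZl//; last by apply: (integrableB _ iv isin).
  by apply: eq_Rintegral => r _; rewrite /bigF; ring.
Qed.

End integrability.

Local Close Scope classical_set_scope.

Theorem lemma2p3 (R : realType) :
  [/\ forall v : R, is_derive v 1 bigF (smallf v),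
      forall z1 z2 : R, smallf z1 * (z2 - z1) <= bigF z2 - bigF z1 &
      forall u w : R -> R, H1r0 u -> H1r0 w ->
        (dotr (fun r => smallf (u r) / r ^+ 2)%R (fun r => w r - u r)%R <=
         (2^-1)%:E * (normH1r w ^+ 2 - normH1r u ^+ 2)
         + energy u - energy w)%E].
Proof.
split; [exact: is_derive_bigF|exact: bigF_above_tangent|].
move=> u w Hu Hw.
have [a [e [-> -> ae]]] := half_normH1r_sub_energy _ Hu.
have [b [k [-> -> bk]]] := half_normH1r_sub_energy _ Hw.
rewrite -EFinB /dotr.
under eq_integral do rewrite div_sqr_mulE.
have ifu := intI_smallf _ _ Hu Hw.
have iFu := intI_bigF _ Hu; have iFw := intI_bigF _ Hw.
rewrite integral_Rintegral// lee_fin.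
have -> : 2^-1 * (b - a) + e - k = (2^-1 * b - k) - (2^-1 * a - e) by ring.
rewrite ae bk -RintegralB//; apply: le_Rintegral => //.
  by apply: (integrableB _ iFw iFu).
move=> r; rewrite /= in_itv /= => /andP[r0 _].
by rewrite -mulrBl ler_wpM2r ?invr_ge0 ?bigF_above_tangent.
Qed.
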